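(* Let $\mathbf{I} = (X,f,x_0)$ be an iterator. (1) There exists a unique assignment $\omega$ of finite sets in $\mathbf{I}$. (2) If $A$ and $B$ are finite sets with $A \approx B$ then $\omega(A) = \omega(B)$.
   Context: A set $E$ is finite if $\mathcal{P}(E)$ is the only subset $\mathcal{S}$ of the power set $\mathcal{P}(E)$ such that $\varnothing \in \mathcal{S}$ and $F \cup \{e\} \in \mathcal{S}$ whenever $F \in \mathcal{S}$, $F \neq E$ and $e \in E \setminus F$ (this is equivalent to the usual notion of finiteness). $\mathsf{Fin}$ denotes the (proper) class of all finite sets; $A \approx B$ means there exists a bijective mapping $A \to B$. An iterator is a triple $\mathbf{I} = (X,f,x_0)$ with $X$ a class (a set or a proper class), $f : X \to X$ a mapping and $x_0$ an element of $X$. An assignment of finite sets in $\mathbf{I}$ is a mapping $\omega : \mathsf{Fin} \to X$ with $\omega(\varnothing) = x_0$ and $\omega(A \cup \{a\}) = f(\omega(A))$ for each finite set $A$ and each element $a \notin A$. *)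

(* Defs.v *)
From mathcomp Require Import ssreflect ssrbool ssrfun.
From Stdlib Require Import Classical.

Set Implicit Arguments.
Unset Strict Implicit.
Unset Printing Implicit Defensive.

Declare Scope uset_scope.
Delimit Scope uset_scope with uset.

(* The ambient set theory is an arbitrary model of the axioms below. Classes are
   Rocq predicates on the model and separation ranges over all of them.
   Replacement, infinity, foundation and choice are not required. *)
Record set_universe := SetUniverse {
  uset :> Type;
  mem : uset -> uset -> Prop;
  empty : uset;
  pair : uset -> uset -> uset;
  bigunion : uset -> uset;
  powerset : uset -> uset;
  sep : uset -> (uset -> Prop) -> uset;
  extensionality : forall A B, (forall x, mem x A <-> mem x B) -> A = B;
  mem_empty : forall x, ~ mem x empty;
  mem_pair : forall x a b, mem x (pair a b) <-> x = a \/ x = b;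
  mem_bigunion : forall x A, mem x (bigunion A) <-> exists2 B, mem B A & mem x B;
  mem_powerset : forall B A, mem B (powerset A) <-> forall x, mem x B -> mem x A;
  mem_sep : forall x A (P : uset -> Prop), mem x (sep A P) <-> mem x A /\ P x
}.

Arguments mem {s}.
Arguments empty {s}.
Arguments pair {s}.
Arguments bigunion {s}.
Arguments powerset {s}.
Arguments sep {s}.

Definition subset (V : set_universe) (A B : V) : Prop :=
  forall x : V, mem x A -> mem x B.
Definition singleton (V : set_universe) (a : V) : V := pair a a.
Definition union (V : set_universe) (A B : V) : V := bigunion (pair A B).

Notation "x ∈ A" := (mem x A) (at level 70) : uset_scope.
Notation "x ∉ A" := (~ mem x A) (at level 70) : uset_scope.
Notation "A ⊆ B" := (subset A B) (at level 70) : uset_scope.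
Notation "A ∪ B" := (union A B) (at level 50, left associativity) : uset_scope.
Notation "∅" := empty : uset_scope.
Notation "﹛ a ﹜" := (singleton a) (at level 0, a at level 99) : uset_scope.
Notation "'𝒫' E" := (powerset E) (at level 9, E at level 8) : uset_scope.

Local Open Scope uset_scope.

Definition class (V : set_universe) := V -> Prop.

Definition class_of_set (V : set_universe) (A : V) : class V := fun x => x ∈ A.

(* A mapping between classes (or sets) X and Y is a function elt X -> elt Y. *)
Definition elt (V : set_universe) (X : class V) : Type := {x : V | X x}.

Definition equipotent (V : set_universe) (A B : V) : Prop :=
  exists h : elt (class_of_set A) -> elt (class_of_set B), bijective h.

Notation "A ≈ B" := (equipotent A B) (at level 70) : uset_scope.

Definition augmentable (V : set_universe) (E S : V) : Prop :=
  [/\ S ⊆ 𝒫 E, ∅ ∈ S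
    & forall F e : V, F ∈ S -> F <> E -> e ∈ E -> e ∉ F -> F ∪ ﹛e﹜ ∈ S].

Definition finite (V : set_universe) (E : V) : Prop :=
  unique (augmentable E) (𝒫 E).

Definition Fin (V : set_universe) : class V := fun E => finite E.
Arguments Fin : clear implicits.

Record iterator (V : set_universe) := Iterator {
  iter_class : class V;
  iter_map : elt iter_class -> elt iter_class;
  iter_base : elt iter_class
}.

Lemma mem_adjoin (V : set_universe) (A : V) (a x : V) :
  x ∈ A ∪ ﹛a﹜ <-> x ∈ A \/ x = a.
Proof.
rewrite mem_bigunion; split.
  move=> [B /mem_pair [->|->]]; first by left.
  by move=> /mem_pair; tauto.
move=> [xA|->]; first by exists A => //; apply/mem_pair; left.
by exists ﹛a﹜; apply/mem_pair; [right|left].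
Qed.

Lemma powerset_augmentable (V : set_universe) (E : V) : augmentable E (𝒫 E).
Proof.
split=> [//||F e /mem_powerset FE _ eE _].
  by apply/mem_powerset => x /mem_empty.
by apply/mem_powerset => x /mem_adjoin [/FE|->].
Qed.

Lemma finite_ind (V : set_universe) (E : V) (P : V -> Prop) :
  finite E -> P ∅ ->
  (forall F e : V, F ⊆ E -> P F -> e ∈ E -> e ∉ F -> P (F ∪ ﹛e﹜)) ->
  forall F : V, F ⊆ E -> P F.
Proof.
move=> [_ finE] P0 PS F FE.
suff /finE eqP : augmentable E (sep (𝒫 E) P).
  by move/mem_powerset: FE; rewrite eqP => /mem_sep [].
have [_ E0 ES] := powerset_augmentable E.
split=> [G /mem_sep []//||G e /mem_sep [GE PG] neq eE eG].
  exact/mem_sep.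
apply/mem_sep; split; first exact: ES.
by apply: PS => //; apply/mem_powerset.
Qed.

Lemma finite_empty (V : set_universe) : finite (∅ : V).
Proof.
split=> [|S [S0 eS _]]; first exact: powerset_augmentable.
apply: extensionality => x; split=> [/mem_powerset x0|/S0//].
suff -> : x = ∅ by [].
by apply: extensionality => y; split=> [/x0|/mem_empty].
Qed.

Lemma finite_adjoin (V : set_universe) (E a : V) : finite E -> finite (E ∪ ﹛a﹜).
Proof.
move=> finE; split=> [|S [SE S0 SS]]; first exact: powerset_augmentable.
have [aE|aE] := classic (a ∈ E).
  have EE : E ∪ ﹛a﹜ = E.
    by apply: extensionality => x; rewrite mem_adjoin; split=> [[//|->//]|]; left.
  by case: finE => _; rewrite EE in SE SS *; apply.
have sub1 : forall F : V, F ⊆ E -> F ∈ S.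
  apply: finite_ind => // F e FE FS eE eF.
  apply: SS => //; last by apply/mem_adjoin; left.
  by move=> eqF; apply/eF; rewrite eqF; apply/mem_adjoin; left.
have sub2 : forall F : V, F ⊆ E -> F ∪ ﹛a﹜ ∈ S.
  apply: finite_ind => // [|F e FE FS eE eF].
    apply: SS => //; try by [apply/mem_adjoin; right | exact: mem_empty].
    by move=> eq0; apply: (@mem_empty V a); rewrite eq0; apply/mem_adjoin; right.
  have neqea : e <> a by move=> eqea; apply: aE; rewrite -eqea.
  have eFa : e ∉ F ∪ ﹛a﹜ by rewrite mem_adjoin; tauto.
  have -> : F ∪ ﹛e﹜ ∪ ﹛a﹜ = F ∪ ﹛a﹜ ∪ ﹛e﹜.
    by apply: extensionality => x; rewrite !mem_adjoin; tauto.
  apply: SS => //; last by apply/mem_adjoin; left.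
  by move=> eqF; apply: eFa; rewrite eqF; apply/mem_adjoin; left.
apply: extensionality => G; split=> [/mem_powerset GE|/SE//].
have [aG|aG] := classic (a ∈ G); last first.
  by apply: sub1 => x xG; case/mem_adjoin: (GE x xG) => // xa; rewrite xa in xG.
have -> : G = sep G (fun x => x <> a) ∪ ﹛a﹜.
  apply: extensionality => x; rewrite mem_adjoin mem_sep.
  have [->|] := classic (x = a); tauto.
by apply: sub2 => x /mem_sep [/GE /mem_adjoin []].
Qed.

Definition Fin_empty (V : set_universe) : elt (Fin V) :=
  exist _ ∅ (finite_empty V).

Definition Fin_adjoin (V : set_universe) (A : elt (Fin V)) (a : V) :
    elt (Fin V) :=
  exist _ (sval A ∪ ﹛a﹜) (finite_adjoin a (svalP A)).
Arguments Fin_empty : clear implicits.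

Definition is_assignment (V : set_universe) (I : iterator V)
    (w : elt (Fin V) -> elt (iter_class I)) : Prop :=
  w (Fin_empty V) = iter_base I /\
  forall (A : elt (Fin V)) (a : V), a ∉ sval A ->
    w (Fin_adjoin A a) = iter_map (w A).

(* Main.v *)
From mathcomp Require Import ssreflect ssrbool ssrfun.
From Stdlib Require Import ProofIrrelevance FunctionalExtensionality.
From Stdlib Require Import IndefiniteDescription.
Require Import Defs.

(** Call [x] a value of the set [A] if it is obtained from the base point by
    adding the elements of [A] one at a time to the empty set, applying the map
    of the iterator at each step. Every finite set has a value, and an
    assignment has to send each finite set to one of its values; so everything
    reduces to showing that a set has at most one value, whatever the order in
    which its elements are added.

    This independence and the invariance under bijections are one and the same
    statement, [value_equipotent]: values of equipotent sets are equal. It is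
    proved by induction on the way the first value is built. The empty set is
    equipotent only to itself, and if [A ∪ ﹛a﹜] and [B ∪ ﹛b﹜] are equipotent,
    with [a] and [b] new, then so are [A] and [B] ([corresponds_remove]). The
    identity correspondence gives the uniqueness of values; hence choosing a
    value of each finite set defines an assignment, and it is the only one. *)

Set Implicit Arguments.
Unset Strict Implicit.
Unset Printing Implicit Defensive.

Local Open Scope uset_scope.

(** Bijections are handled as relations on the whole universe: restricting one
    to smaller sets or changing it at a point then needs no subtypes, and
    reversing it exchanges the two halves below. *)
Definition maps_to (V : set_universe) (R : V -> V -> Prop) (A B : V) : Prop :=
  forall x : V, x ∈ A -> exists! y, y ∈ B /\ R x y.

Definition corresponds (V : set_universe) (R : V -> V -> Prop) (A B : V) :
    Prop :=
  maps_to R A B /\ maps_to (fun y x => R x y) B A.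

Lemma corresponds_refl (V : set_universe) (A : V) : corresponds eq A A.
Proof. by split=> x xA; exists x; split=> // y []. Qed.

Lemma equipotent_corresponds (V : set_universe) (A B : V) :
  A ≈ B -> exists R, corresponds R A B.
Proof.
move=> [h [g hK gK]].
exists (fun x y => exists2 u, sval u = x & sval (h u) = y).
split=> [x xA|y yB].
  exists (sval (h (exist _ x xA))); split.
    by split; [exact: (svalP (h _)) | exists (exist _ x xA)].
  move=> _ [_ [[x' x'A] /= ex <-]]; subst x'.
  by rewrite (proof_irrelevance _ x'A xA).
exists (sval (g (exist _ y yB))); split.
  by split; [exact: (svalP (g _)) | exists (g (exist _ y yB)); rewrite ?gK].
move=> _ [_ [u <- hu]]; congr (sval _); apply: (can_inj hK); rewrite gK.
case: (h u) hu => y' y'B /= ey; subst y'.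
by rewrite (proof_irrelevance _ y'B yB).
Qed.

(** The relation [R'] sends the element that [R] matched with [b] to the partner
    of [a], and agrees with [R] elsewhere. When [R] matches [a] with [b] the
    second alternative never occurs on [A] and [B]. *)
Lemma maps_to_remove (V : set_universe) (R R' : V -> V -> Prop) (A B a b : V) :
  corresponds R (A ∪ ﹛a﹜) (B ∪ ﹛b﹜) -> a ∉ A -> b ∉ B ->
  (forall x y, R' x y <-> R x y \/ (R x b /\ R a y)) ->
  maps_to R' A B.
Proof.
move=> [Rf Rg] aA bB R'E x xA.
have inA z : z ∈ A -> z ∈ A ∪ ﹛a﹜ by rewrite mem_adjoin; left.
have inB z : z ∈ B -> z ∈ B ∪ ﹛b﹜ by rewrite mem_adjoin; left.
have aAa : a ∈ A ∪ ﹛a﹜ by apply/mem_adjoin; right.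
have bBb : b ∈ B ∪ ﹛b﹜ by apply/mem_adjoin; right.
have [y [[/mem_adjoin yB Rxy] yU]] := Rf x (inA x xA).
case: yB => [yB|yb].
  exists y; split; first by split=> //; apply/R'E; left.
  move=> z [zB /R'E [Rxz|[Rxb _]]]; first by apply: yU; split=> //; apply: inB.
  by case: bB; rewrite -(yU b (conj bBb Rxb)).
subst y.
have [y [[/mem_adjoin yB Ray] yU']] := Rf a aAa.
case: yB => [yB|yb].
  exists y; split; first by split=> //; apply/R'E; right.
  move=> z [zB /R'E [Rxz|[_ Raz]]]; last by apply: yU'; split=> //; apply: inB.
  by case: bB; rewrite (yU z (conj (inB z zB) Rxz)).
subst y; have [c [_ cU]] := Rg b bBb.
by case: aA; rewrite -(cU a (conj aAa Ray)) (cU x (conj (inA x xA) Rxy)).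
Qed.

Lemma corresponds_remove (V : set_universe) (R : V -> V -> Prop)
    (A B a b : V) :
  corresponds R (A ∪ ﹛a﹜) (B ∪ ﹛b﹜) -> a ∉ A -> b ∉ B ->
  exists R', corresponds R' A B.
Proof.
move=> RAB aA bB; exists (fun x y => R x y \/ (R x b /\ R a y)); split.
  exact: (maps_to_remove RAB).
have RBA : corresponds (fun y x => R x y) (B ∪ ﹛b﹜) (A ∪ ﹛a﹜).
  by case: RAB; split.
by apply: (maps_to_remove RBA) => // y x; tauto.
Qed.

(** A graph rather than a function, since the result might a priori depend on
    the order in which the elements of the set are added. *)
Inductive value (V : set_universe) (I : iterator V) :
    V -> elt (iter_class I) -> Prop :=
| value_empty : value ∅ (iter_base I)
| value_adjoin A a x : value A x -> a ∉ A -> value (A ∪ ﹛a﹜) (iter_map x).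

Lemma value_equipotent (V : set_universe) (I : iterator V) (A B : V)
    (R : V -> V -> Prop) (x y : elt (iter_class I)) :
  value A x -> value B y -> corresponds R A B -> x = y.
Proof.
move=> vA; elim: vA B R y => {A x} [|A a x _ IH aA] B R y [|{}B b {}y vB bB].
- by [].
- move=> [_ /(_ b)] []; first by apply/mem_adjoin; right.
  by move=> c [[/mem_empty]].
- move=> [/(_ a) []]; first by apply/mem_adjoin; right.
  by move=> c [[/mem_empty]].
- move=> RAB; have [R' R'AB] := corresponds_remove RAB aA bB.
  by rewrite (IH _ _ _ vB R'AB).
Qed.

Lemma value_unique (V : set_universe) (I : iterator V) (A : V)
    (x y : elt (iter_class I)) :
  value A x -> value A y -> x = y.
Proof. by move=> vx vy; apply: (value_equipotent vx vy (corresponds_refl A)). Qed.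

Lemma value_exists (V : set_universe) (I : iterator V) (A : V) :
  finite A -> exists x : elt (iter_class I), value A x.
Proof.
move=> finA; apply: (finite_ind finA (P := fun F => exists x, value F x)) => //.
  by exists (iter_base I); apply: value_empty.
by move=> F e _ [x vx] _ eF; exists (iter_map x); apply: value_adjoin.
Qed.

Lemma assignment_value (V : set_universe) (I : iterator V)
    (w : elt (Fin V) -> elt (iter_class I)) :
  is_assignment w -> forall A : elt (Fin V), value (sval A) (w A).
Proof.
move=> [w0 wS] [A finA] /=.
(* The induction runs over subsets of [A], so their finiteness, which [w]
   takes as an argument, has to be carried along. *)
pose P F := exists finF : finite F, value F (w (exist _ F finF)).
suff [finA' vA] : P A by rewrite (proof_irrelevance _ finA finA').
apply: (finite_ind finA (P := P)) => // [|F e _ [finF vF] _ eF].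
  by exists (finite_empty V); rewrite [w _]w0; apply: value_empty.
(* This detour through [svalP] gives the very finiteness proof that occurs in
   [Fin_adjoin], so that [wS] applies up to conversion. *)
exists (finite_adjoin e (svalP (exist (Fin V) F finF))).
by rewrite [w _](wS (exist _ F finF) e eF); apply: value_adjoin.
Qed.

Theorem theorem7p1 (V : set_universe) (I : iterator V) :
  (exists! w : elt (Fin V) -> elt (iter_class I), is_assignment w) /\
  (forall w : elt (Fin V) -> elt (iter_class I), is_assignment w ->
     forall A B : elt (Fin V),
       proj1_sig A ≈ proj1_sig B -> w A = w B).
Proof.
split; last first.
  move=> w /assignment_value wv A B /equipotent_corresponds [R].
  exact: value_equipotent.
have [w wv] := functional_choice (fun A x => value (sval A) x)
  (fun A : elt (Fin V) => value_exists I (svalP A)).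
exists w; split; last first.
  move=> w' /assignment_value w'v; apply: functional_extensionality => A.
  exact: value_unique (wv A) (w'v A).
split=> [|A a aA]; first exact: value_unique (wv (Fin_empty V)) (value_empty I).
exact: value_unique (wv (Fin_adjoin A a)) (value_adjoin (wv A) aA).
Qed.
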